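(* In the setting of the context, suppose the destination's payoff $\Pi^B(q;p,v)$ is strictly concave in $q$ and the origin's reduced payoff $\Pi^A(p,v)$ is concave in $(p,v)$. Then: 1. destination recognition $q^*(p,v)$ is nondecreasing in $v$; 2. portability $p$ and verification $v$ are strategic complements for the origin if $\Psi(p,v)\ge 0$ and strategic substitutes if $\Psi(p,v)<0$, where $$\Psi(p,v)\equiv\Pi^A_{pv}=N\Big([s''(e)-c]\,e_p e_v+\Delta\,e_{pv}-r_{pv}\,e-r_p e_v\Big)-Q_{pv};$$ 3. a sufficient condition for complementarity is $$-Q_{pv}+N\Delta\,e_{pv}\ \ge\ N\Big([c-s''(e)]\,e_p e_v+r_{pv}\,e+r_p e_v\Big).$$
   Context: An origin platform grants an export (portability) entitlement $p\in[0,1]$ and chooses evidence (verification) reliability $v\in[0,1]$; a destination platform, observing $(p,v)$, chooses the share $q\in[0,1]$ of the entitlement that it recognizes. There are $N\ge 2$ developers; $c>0$, $\mu>0$, $r_0\ge 0$. The functions $F,G$ satisfy $F'>0$, $F''\le 0$, $G'>0$, $G''\le 0$. Destination: given $(p,q)$, a developer's outside return is $r_0+\mu pq$, its investment is $(r_0+\mu pq)/c$, and recognized imported capability is $m(p,q)=pq\,(r_0+\mu pq)/c$. The destination's payoff is $$\Pi^B(q;p,v)=D(m(p,q))-K_B(q)-(1-v)L(pq),$$ where $D$ is concave (value of imports), $K_B$ is convex (recognition cost), and $L$ is import harm, for which $\Pi^B_{qv}=pL'(pq)\ge 0$. $q^*(p,v)$ is the destination's optimal choice of $q\in[0,1]$.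 Origin: anticipating $q^*(p,v)$, put $r(p,v)=r_0+\mu p\,q^*(p,v)$, $e=e(p,v)=r(p,v)/c$, $S(e)=NF(e)+G(Ne)$, $s'(e)=F'(e)+G'(Ne)$ (so $s''(e)=F''(e)+NG''(Ne)$), and $\Delta=s'(e)-r$. The function $Q(p,v)$ collects the origin's conversion, leakage, transfer and verification costs after the destination's response. The origin's reduced payoff is $$\Pi^A(p,v)=S(e)-N\,r(p,v)\,e-Q(p,v).$$ Subscripts $p,v$ denote partial derivatives. Strategic complementarity refers to increasing differences of $\Pi^A$ in $(p,v)$; strategic substitutability is meant in the local sense. *)

(* Defs.v *)
(* Stdlib real numbers with Coquelicot. *)
From Stdlib Require Import Reals.
From Coquelicot Require Import Coquelicot.
Open Scope R_scope.

Definition unit_itv (x : R) : Prop := 0 <= x <= 1.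

Definition concave_on {V : ModuleSpace R_Ring} (A : V -> Prop) (f : V -> R) : Prop :=
  forall (x y : V) (t : R), A x -> A y -> 0 <= t <= 1 ->
    t * f x + (1 - t) * f y <= f (plus (scal t x) (scal (1 - t) y)).

Definition strictly_concave_on {V : ModuleSpace R_Ring} (A : V -> Prop) (f : V -> R) : Prop :=
  forall (x y : V) (t : R), A x -> A y -> x <> y -> 0 < t < 1 ->
    t * f x + (1 - t) * f y < f (plus (scal t x) (scal (1 - t) y)).

Definition convex_on {V : ModuleSpace R_Ring} (A : V -> Prop) (f : V -> R) : Prop :=
  concave_on A (fun x => - f x).

(* Functions are total on R, so smoothness on a closed domain means smoothness
   on a neighbourhood of each of its points: at a boundary point the two-sided
   derivatives below are those of a C^2 extension, and agree with the one-sided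
   derivatives of the restriction to the domain. *)
Definition C2_near (f : R -> R) (x : R) : Prop :=
  locally x (fun y =>
    (forall k : nat, (k <= 2)%nat -> ex_derive_n f k y) /\
    continuous (Derive_n f 2) y).

(* [ex_diff_n f 2 x y] : all partial derivatives of [f] up to order two exist
   and are jointly continuous at (x, y). *)
Definition C2_on_square (f : R -> R -> R) : Prop :=
  forall x y : R, unit_itv x -> unit_itv y ->
    locally_2d (fun x' y' => ex_diff_n f 2 x' y') x y.

(* The arguments of a two-variable function are ordered (p, v).  In Coquelicot
   [partial_derive 1 1 f] differentiates in v first; for C^2 functions the
   order is immaterial. *)
Definition D_p (f : R -> R -> R) : R -> R -> R := partial_derive 1 0 f.
Definition D_v (f : R -> R -> R) : R -> R -> R := partial_derive 0 1 f.
Definition D_pv (f : R -> R -> R) : R -> R -> R := partial_derive 1 1 f.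

(* [D_pv f p v = l], with the derivatives involved required to exist. *)
Definition is_cross_partial (f : R -> R -> R) (p v l : R) : Prop :=
  locally p (fun x => ex_derive (fun y => f x y) v) /\
  is_derive (fun x => D_v f x v) p l.

Definition increasing_differences (I J : R -> Prop) (f : R -> R -> R) : Prop :=
  forall p p' v v' : R, I p -> I p' -> J v -> J v' -> p <= p' -> v <= v' ->
    f p' v - f p v <= f p' v' - f p v'.

Definition strictly_decreasing_differences (I J : R -> Prop) (f : R -> R -> R) : Prop :=
  forall p p' v v' : R, I p -> I p' -> J v -> J v' -> p < p' -> v < v' ->
    f p' v' - f p v' < f p' v - f p v.

Definition strategic_complements_on_box (a b a' b' : R) (f : R -> R -> R) : Prop :=
  increasing_differences (fun x => a <= x <= b) (fun y => a' <= y <= b') f.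

Definition local_strategic_substitutes (f : R -> R -> R) (p v : R) : Prop :=
  exists eps : R, 0 < eps /\
    strictly_decreasing_differences
      (fun x => unit_itv x /\ Rabs (x - p) < eps)
      (fun y => unit_itv y /\ Rabs (y - v) < eps) f.

Definition imported (c mu r0 p q : R) : R := p * q * (r0 + mu * p * q) / c.

Definition PiB (c mu r0 : R) (D KB L : R -> R) (q p v : R) : R :=
  D (imported c mu r0 p q) - KB q - (1 - v) * L (p * q).

Definition optimal_recognition (c mu r0 : R) (D KB L : R -> R) (p v q : R) : Prop :=
  unit_itv q /\
  forall q' : R, unit_itv q' -> PiB c mu r0 D KB L q' p v <= PiB c mu r0 D KB L q p v.

Definition ret (mu r0 : R) (qs : R -> R -> R) (p v : R) : R := r0 + mu * p * qs p v.

Definition invest (c mu r0 : R) (qs : R -> R -> R) (p v : R) : R := ret mu r0 qs p v / c.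

Definition surplus (N : nat) (F G : R -> R) (e : R) : R :=
  INR N * F e + G (INR N * e).

(* s'(e), which is the derivative of [surplus] divided by N, and s''(e) *)
Definition s1 (N : nat) (F G : R -> R) (e : R) : R :=
  Derive F e + Derive G (INR N * e).

Definition s2 (N : nat) (F G : R -> R) (e : R) : R :=
  Derive_n F 2 e + INR N * Derive_n G 2 (INR N * e).

Definition wedge (N : nat) (c mu r0 : R) (F G : R -> R) (qs : R -> R -> R) (p v : R) : R :=
  s1 N F G (invest c mu r0 qs p v) - ret mu r0 qs p v.

Definition PiA (N : nat) (c mu r0 : R) (F G : R -> R) (Q qs : R -> R -> R) (p v : R) : R :=
  surplus N F G (invest c mu r0 qs p v)
  - INR N * ret mu r0 qs p v * invest c mu r0 qs p v - Q p v.

Definition Psi (N : nat) (c mu r0 : R) (F G : R -> R) (Q qs : R -> R -> R) (p v : R) : R :=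
  let r := ret mu r0 qs in
  let e := invest c mu r0 qs in
  INR N * ((s2 N F G (e p v) - c) * D_p e p v * D_v e p v
           + wedge N c mu r0 F G qs p v * D_pv e p v
           - D_pv r p v * e p v - D_p r p v * D_v e p v)
  - D_pv Q p v.

Definition complementarity_condition (N : nat) (c mu r0 : R) (F G : R -> R)
    (Q qs : R -> R -> R) (p v : R) : Prop :=
  let r := ret mu r0 qs in
  let e := invest c mu r0 qs in
  - D_pv Q p v + INR N * wedge N c mu r0 F G qs p v * D_pv e p v >=
  INR N * ((c - s2 N F G (e p v)) * D_p e p v * D_v e p v
           + D_pv r p v * e p v + D_p r p v * D_v e p v).

(* Main.v *)
(* Monotonicity of [qs] in [v] is revealed preference: strict concavity makes the
   optimum unique, so two optimality inequalities contradict a decrease of [q]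
   because [q |-> L (p q)] is nondecreasing.  For the origin, [r = c e] turns the
   payoff into [h (e(p,v)) - Q(p,v)] with [h] a function of one variable, and the
   chain rule gives [Psi].  The mean value theorem applied once in each variable
   writes the mixed difference over a rectangle as [Psi] at one of its points times
   its area; the local statement then uses the continuity of [Psi]. *)

Require Import Defs.
From Stdlib Require Import Reals Lra Lia.
From Coquelicot Require Import Coquelicot.
Open Scope R_scope.

(** * Mixed differences over a rectangle and the sign of the cross partial *)

Lemma MVT_derive (f df : R -> R) (a b : R) :
  a <= b -> (forall x, a <= x <= b -> is_derive f x (df x)) ->
  exists xi, a <= xi <= b /\ f b - f a = df xi * (b - a).
Proof.
  intros Hab Hd.
  destruct (MVT_gen f a b df) as [xi [Hxi E]];
    rewrite ?Rmin_left, ?Rmax_right in * by lra.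
  - intros x Hx; apply Hd; lra.
  - intros x Hx; apply derivable_continuous_pt, ex_derive_Reals_0.
    exists (df x); apply Hd, Hx.
  - now exists xi.
Qed.

(** The mean value theorem acts first in [y], on [f b y - f a y], and then in [x], on [D_v f x y]:
    the order in which [is_cross_partial] differentiates. *)
Lemma mixed_difference (f l : R -> R -> R) (a b a' b' : R) :
  a <= b -> a' <= b' ->
  (forall x y, a <= x <= b -> a' <= y <= b' -> is_cross_partial f x y (l x y)) ->
  exists x y, a <= x <= b /\ a' <= y <= b' /\
    (f b b' - f a b') - (f b a' - f a a') = l x y * (b - a) * (b' - a').
Proof.
  intros Hab Hab' H.
  destruct (MVT_derive (fun y => f b y - f a y)
              (fun y => D_v f b y - D_v f a y) a' b') as [y [Hy Ey]].
  - exact Hab'.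
  - intros y Hy.
    apply (is_derive_minus (fun y => f b y) (fun y => f a y) y); apply Derive_correct.
    + exact (locally_singleton _ _ (proj1 (H b y ltac:(lra) Hy))).
    + exact (locally_singleton _ _ (proj1 (H a y ltac:(lra) Hy))).
  - destruct (MVT_derive (fun x => D_v f x y) (fun x => l x y) a b) as [x [Hx Ex]].
    + exact Hab.
    + intros x Hx; apply (H x y Hx Hy).
    + exists x, y; rewrite <- Ex, <- Ey; auto.
Qed.

Lemma increasing_differences_of_cross (f l : R -> R -> R) (a b a' b' : R) :
  (forall x y, a <= x <= b -> a' <= y <= b' ->
     is_cross_partial f x y (l x y) /\ 0 <= l x y) ->
  strategic_complements_on_box a b a' b' f.
Proof.
  intros H p p' v v' Hp Hp' Hv Hv' Hpp Hvv.
  destruct (mixed_difference f l p p' v v') as (x & y & Hx & Hy & E); trivial.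
  - intros x y Hx Hy; apply H; lra.
  - assert (0 <= l x y * (p' - p) * (v' - v)).
    { repeat apply Rmult_le_pos; try lra; apply H; lra. }
    lra.
Qed.

Lemma local_substitutes_of_cross (f l : R -> R -> R) (p v : R) :
  (forall x y, unit_itv x -> unit_itv y -> is_cross_partial f x y (l x y)) ->
  continuity_2d_pt l p v -> l p v < 0 ->
  local_strategic_substitutes f p v.
Proof.
  intros Hl Hc Hneg.
  (* The tolerance [- l p v] is the distance from [l p v] to zero, so [l] stays negative within [d]
     of the point. *)
  destruct (Hc (mkposreal (- l p v) ltac:(lra))) as [d Hd]; simpl in Hd.
  exists d; split; [apply cond_pos|].
  intros x x' y y' [Hx Hxd] [Hx' Hxd'] [Hy Hyd] [Hy' Hyd'] Hxx Hyy.
  unfold unit_itv in *.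
  apply Rabs_def2 in Hxd, Hxd', Hyd, Hyd'.
  destruct (mixed_difference f l x x' y y') as (s & t & Hs & Ht & E); try lra.
  - intros s t Hs Ht; apply Hl; unfold unit_itv; lra.
  - assert (Hst : l s t < 0).
    { specialize (Hd s t).
      assert (Rabs (s - p) < d) by (apply Rabs_def1; lra).
      assert (Rabs (t - v) < d) by (apply Rabs_def1; lra).
      pose proof (Rabs_def2 _ _ (Hd ltac:(assumption) ltac:(assumption))); lra. }
    assert (0 < - l s t * (x' - x) * (y' - y)).
    { repeat apply Rmult_lt_0_compat; lra. }
    lra.
Qed.

(** * Cross partials of differences and compositions *)

Lemma is_cross_partial_D_pv (f : R -> R -> R) (p v : R) :
  locally_2d (ex_diff_n f 2) p v -> is_cross_partial f p v (D_pv f p v).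
Proof.
  intros H; split.
  - apply locally_2d_1d_const_y in H; revert H; apply filter_imp.
    intros x (_ & _ & Hy & _); exact Hy.
  - apply locally_2d_singleton in H.
    (* The last component of [ex_diff_n] concerns the derivative in [y]; what is extracted is its
       differentiability in [x]. *)
    destruct H as (_ & _ & _ & _ & (_ & H & _)).
    apply Derive_correct, H.
Qed.

Lemma is_cross_partial_minus (f g : R -> R -> R) (p v l m : R) :
  is_cross_partial f p v l -> is_cross_partial g p v m ->
  is_cross_partial (fun x y => f x y - g x y) p v (l - m).
Proof.
  intros [Hf Hf'] [Hg Hg']; split.
  - generalize (filter_and _ _ Hf Hg); apply filter_imp.
    intros x [H1 H2]; exact (ex_derive_minus _ _ _ H1 H2).
  - apply (is_derive_ext_loc (fun x => D_v f x v - D_v g x v)).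
    + generalize (filter_and _ _ Hf Hg); apply filter_imp.
      intros x [H1 H2]; symmetry; exact (Derive_minus _ _ _ H1 H2).
    + exact (is_derive_minus _ _ _ _ _ Hf' Hg').
Qed.

(** The chain rule in [y] gives [D_v g * h1 (g)] with [h1] the derivative of [h]; the product and
    chain rules in [x] then give the second-order formula. *)
Lemma is_cross_partial_comp (h h1 : R -> R) (g : R -> R -> R) (p v h2 l : R) :
  locally (g p v) (fun z => is_derive h z (h1 z)) ->
  is_derive h1 (g p v) h2 ->
  ex_derive (fun x => g x v) p ->
  is_cross_partial g p v l ->
  is_cross_partial (fun x y => h (g x y)) p v
    (h2 * D_p g p v * D_v g p v + h1 (g p v) * l).
Proof.
  intros Hh Hh1 Hgp [Hgv Hg].
  assert (Hloc : locally p (fun x => is_derive (fun y => h (g x y)) v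
                                       (D_v g x v * h1 (g x v)))).
  (* Continuity of [g] in its first argument pulls the neighbourhood of [g p v] where [h] is
     differentiable back to a neighbourhood of [p]. *)
  { assert (Hc := ex_derive_continuous _ _ Hgp _ Hh).
    generalize (filter_and _ _ Hgv Hc); apply filter_imp.
    intros x [H1 H2].
    apply (is_derive_comp h (fun y => g x y)); [exact H2|].
    apply Derive_correct, H1. }
  split.
  - revert Hloc; apply filter_imp; intros x H; eexists; exact H.
  - apply (is_derive_ext_loc (fun x => D_v g x v * h1 (g x v))).
    + revert Hloc; apply filter_imp.
      intros x H; symmetry; exact (is_derive_unique _ _ _ H).
    + replace (h2 * D_p g p v * D_v g p v + h1 (g p v) * l)
        with (l * h1 (g p v) + D_v g p v * (D_p g p v * h2)) by ring.
      apply (is_derive_mult (fun x => D_v g x v) (fun x => h1 (g x v)));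
        [exact Hg| |intros; apply Rmult_comm].
      apply (is_derive_comp h1 (fun x => g x v)); [exact Hh1|].
      apply Derive_correct, Hgp.
Qed.

(** * Joint smoothness of sums and products *)

Lemma ex_diff_n_S (f : R -> R -> R) (n : nat) (x y : R) :
  ex_diff_n f (S n) x y -> ex_diff_n f n x y.
Proof.
  revert f; induction n as [|n IH]; intros f (Hc & Hx & Hy & Hdx & Hdy).
  - now split.
  - split; [exact Hc|]; repeat split; auto.
Qed.

Lemma ex_diff_n_const (a : R) (n : nat) (x y : R) :
  ex_diff_n (fun _ _ => a) n x y.
Proof.
  revert a; induction n as [|n IH]; intros a;
    (split; [apply continuity_2d_pt_const|]); [exact I|].
  repeat split; try apply ex_derive_const;
    apply (ex_diff_n_ext_loc (fun _ _ => 0)); trivial;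
    apply locally_2d_forall; intros; symmetry; apply Derive_const.
Qed.

Lemma ex_diff_n_fst (n : nat) (x y : R) : ex_diff_n (fun u _ => u) n x y.
Proof.
  destruct n as [|n]; (split; [apply continuity_2d_pt_id1|]); [exact I|].
  split; [apply ex_derive_id|split; [apply ex_derive_const|split]].
  - apply (ex_diff_n_ext_loc (fun _ _ => 1)); [|apply ex_diff_n_const].
    apply locally_2d_forall; intros; symmetry; apply Derive_id.
  - apply (ex_diff_n_ext_loc (fun _ _ => 0)); [|apply ex_diff_n_const].
    apply locally_2d_forall; intros; symmetry; apply Derive_const.
Qed.

Lemma locally_2d_imp (P Q : R -> R -> Prop) (x y : R) :
  (forall u v, P u v -> Q u v) -> locally_2d P x y -> locally_2d Q x y.
Proof. intros H; apply locally_2d_impl, locally_2d_forall, H. Qed.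

(** The premise is local because the partial derivative of the sum must equal the sum of the partial
    derivatives on a whole neighbourhood before the induction can continue with it. *)
Lemma ex_diff_n_plus (f g : R -> R -> R) (n : nat) (x y : R) :
  locally_2d (fun u v => ex_diff_n f n u v /\ ex_diff_n g n u v) x y ->
  ex_diff_n (fun u v => f u v + g u v) n x y.
Proof.
  revert f g; induction n as [|n IH]; intros f g Hfg;
    pose proof (locally_2d_singleton _ _ _ Hfg) as [Hf Hg].
  { split; [apply continuity_2d_pt_plus; [apply Hf|apply Hg]|exact I]. }
  destruct Hf as (Hfc & Hfx & Hfy & _), Hg as (Hgc & Hgx & Hgy & _).
  split; [now apply continuity_2d_pt_plus|].
  split; [exact (ex_derive_plus _ _ _ Hfx Hgx)|].
  split; [exact (ex_derive_plus _ _ _ Hfy Hgy)|].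
  split.
  - apply (ex_diff_n_ext_loc (fun u v =>
      Derive (fun z => f z v) u + Derive (fun z => g z v) u)).
    + revert Hfg; apply locally_2d_imp.
      intros u v [(_ & H1 & _) (_ & H2 & _)]; symmetry.
      exact (Derive_plus _ _ _ H1 H2).
    + apply IH; revert Hfg; apply locally_2d_imp.
      intros u v [H1 H2]; split; [apply H1|apply H2].
  - apply (ex_diff_n_ext_loc (fun u v =>
      Derive (fun z => f u z) v + Derive (fun z => g u z) v)).
    + revert Hfg; apply locally_2d_imp.
      intros u v [(_ & _ & H1 & _) (_ & _ & H2 & _)]; symmetry.
      exact (Derive_plus _ _ _ H1 H2).
    + apply IH; revert Hfg; apply locally_2d_imp.
      intros u v [H1 H2]; split; [apply H1|apply H2].
Qed.

(** What holds near a point also holds near every sufficiently close point, so the previous rule,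
    with its local premise, applies throughout a neighbourhood. *)
Lemma locally_2d_ex_diff_n_plus (f g : R -> R -> R) (n : nat) (x y : R) :
  locally_2d (ex_diff_n f n) x y -> locally_2d (ex_diff_n g n) x y ->
  locally_2d (ex_diff_n (fun u v => f u v + g u v) n) x y.
Proof.
  intros Hf Hg; generalize (locally_2d_and _ _ _ _ Hf Hg).
  apply locally_2d_impl_strong, locally_2d_forall; intros u v.
  apply ex_diff_n_plus.
Qed.

(** By the product rule each partial derivative is a sum of two products. The conclusion is local so
    that the induction hypothesis supplies the local premises of the sum rule. *)
Lemma locally_2d_ex_diff_n_mult (f g : R -> R -> R) (n : nat) (x y : R) :
  locally_2d (ex_diff_n f n) x y -> locally_2d (ex_diff_n g n) x y ->
  locally_2d (ex_diff_n (fun u v => f u v * g u v) n) x y.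
Proof.
  revert f g x y; induction n as [|n IH]; intros f g x y Hf Hg;
    generalize (locally_2d_and _ _ _ _ Hf Hg);
    apply locally_2d_impl_strong, locally_2d_forall; clear x y Hf Hg;
    intros x y Hfg;
    pose proof (locally_2d_singleton _ _ _ Hfg) as [Hf Hg].
  { split; [apply continuity_2d_pt_mult; [apply Hf|apply Hg]|exact I]. }
  destruct Hf as (Hfc & Hfx & Hfy & _), Hg as (Hgc & Hgx & Hgy & _).
  split; [now apply continuity_2d_pt_mult|].
  split; [exact (ex_derive_mult _ _ _ Hfx Hgx)|].
  split; [exact (ex_derive_mult _ _ _ Hfy Hgy)|].
  split.
  - apply (ex_diff_n_ext_loc (fun u v =>
      Derive (fun z => f z v) u * g u v + f u v * Derive (fun z => g z v) u)).
    + revert Hfg; apply locally_2d_imp.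
      intros u v [(_ & H1 & _) (_ & H2 & _)]; symmetry.
      exact (Derive_mult _ _ _ H1 H2).
    (* In each product the differentiated factor has order [n], while the other has order [S n] and
       is lowered by [ex_diff_n_S]. *)
    + apply locally_2d_singleton, locally_2d_ex_diff_n_plus; apply IH;
        revert Hfg; apply locally_2d_imp; intros u v [H1 H2];
        first [apply H1 | apply H2 | apply ex_diff_n_S, H1 | apply ex_diff_n_S, H2].
  - apply (ex_diff_n_ext_loc (fun u v =>
      Derive (fun z => f u z) v * g u v + f u v * Derive (fun z => g u z) v)).
    + revert Hfg; apply locally_2d_imp.
      intros u v [(_ & _ & H1 & _) (_ & _ & H2 & _)]; symmetry.
      exact (Derive_mult _ _ _ H1 H2).
    + apply locally_2d_singleton, locally_2d_ex_diff_n_plus; apply IH;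
        revert Hfg; apply locally_2d_imp; intros u v [H1 H2];
        first [apply H1 | apply H2 | apply ex_diff_n_S, H1 | apply ex_diff_n_S, H2].
Qed.

(** * Investment and the cross partial of the origin's payoff *)

Lemma C2_on_square_invest (c mu r0 : R) (qs : R -> R -> R) :
  C2_on_square qs -> C2_on_square (invest c mu r0 qs).
Proof.
  intros Hq x y Hx Hy; unfold invest, ret, Rdiv.
  repeat first
    [ apply locally_2d_ex_diff_n_mult | apply locally_2d_ex_diff_n_plus | exact (Hq x y Hx Hy)
    | apply locally_2d_forall; intros;
      first [apply ex_diff_n_const | apply ex_diff_n_fst] ].
Qed.

(** This places investment in the half-line on which [F] and [G] are assumed smooth. *)
Lemma invest_nonneg (c mu r0 : R) (qs : R -> R -> R) (p v : R) :
  0 < c -> 0 < mu -> 0 <= r0 -> 0 <= p -> 0 <= qs p v ->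
  0 <= invest c mu r0 qs p v.
Proof.
  intros Hc Hmu Hr Hp Hq; unfold invest, ret, Rdiv.
  apply Rmult_le_pos; [|left; now apply Rinv_0_lt_compat].
  apply Rplus_le_le_0_compat; [exact Hr|].
  repeat apply Rmult_le_pos; lra.
Qed.

Lemma ret_invest (c mu r0 : R) (qs : R -> R -> R) (p v : R) :
  c <> 0 -> ret mu r0 qs p v = c * invest c mu r0 qs p v.
Proof. intros Hc; unfold invest; field; exact Hc. Qed.

Lemma C2_near_derive (f : R -> R) (x : R) :
  C2_near f x ->
  locally x (fun y => is_derive f y (Derive f y)) /\
  is_derive (Derive f) x (Derive_n f 2 x) /\
  continuity_pt (Derive_n f 2) x.
Proof.
  unfold C2_near; intros H; split.
  - revert H; apply filter_imp; intros y [H _].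
    apply Derive_correct, (H 1%nat); lia.
  - destruct (locally_singleton x _ H) as [H' Hc]; split.
    + apply Derive_correct, (H' 2%nat); lia.
    + apply continuity_pt_filterlim, Hc.
Qed.

(* Since [r = c e], the origin's payoff is a one-variable function of [e] minus [Q]. *)
Definition net_surplus (N : nat) (c : R) (F G : R -> R) (z : R) : R :=
  surplus N F G z - INR N * c * z * z.

Lemma filterlim_scal (k z : R) :
  filterlim (fun y : R => k * y) (locally z) (locally (k * z)).
Proof. exact (continuous_scal_r k (fun y => y) z (continuous_id z)). Qed.

Lemma is_derive_net_surplus (N : nat) (c : R) (F G : R -> R) (z : R) :
  C2_near F z -> C2_near G (INR N * z) ->
  locally z (fun y => is_derive (net_surplus N c F G) y
                        (INR N * (s1 N F G y - 2 * c * y))).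
Proof.
  intros HF HG.
  destruct (C2_near_derive _ _ HF) as [HF1 _].
  destruct (C2_near_derive _ _ HG) as [HG1 _].
  (* Differentiability of [G] near [INR N * z] becomes differentiability at [INR N * y] for [y] near
     [z]. *)
  apply filterlim_scal in HG1; unfold filtermap in HG1.
  generalize (filter_and _ _ HF1 HG1); apply filter_imp.
  intros y [H1 H2]; unfold net_surplus, surplus, s1.
  auto_derive.
  - repeat split; eexists; eassumption.
  - change (fun x : R => F x) with F; change (fun x : R => G x) with G; ring.
Qed.

Lemma is_derive_net_surplus' (N : nat) (c : R) (F G : R -> R) (z : R) :
  C2_near F z -> C2_near G (INR N * z) ->
  is_derive (fun y => INR N * (s1 N F G y - 2 * c * y)) z
    (INR N * (s2 N F G z - 2 * c)).
Proof.
  intros HF HG.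
  destruct (C2_near_derive _ _ HF) as (_ & HF2 & _).
  destruct (C2_near_derive _ _ HG) as (_ & HG2 & _).
  unfold s1, s2.
  evar_last.
  - apply (is_derive_scal (fun y => Derive F y + Derive G (INR N * y) - 2 * c * y)).
    apply (is_derive_minus (fun y => Derive F y + Derive G (INR N * y))
             (fun y => 2 * c * y)).
    + apply (is_derive_plus (Derive F) (fun y => Derive G (INR N * y))); [exact HF2|].
      apply (is_derive_comp (Derive G) (fun y => INR N * y)); [exact HG2|].
      apply (is_derive_scal (fun y => y)), is_derive_id.
    + apply (is_derive_scal (fun y => y)), is_derive_id.
  - unfold minus, plus, opp, scal; simpl; unfold mult, one; simpl; ring.
Qed.

Lemma continuity_pt_s2 (N : nat) (F G : R -> R) (z : R) :
  C2_near F z -> C2_near G (INR N * z) ->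
  continuity_pt (s2 N F G) z.
Proof.
  intros HF HG.
  destruct (C2_near_derive _ _ HF) as (_ & _ & HF3).
  destruct (C2_near_derive _ _ HG) as (_ & _ & HG3).
  unfold s2.
  apply (continuity_pt_plus (Derive_n F 2) (fun y => INR N * Derive_n G 2 (INR N * y)));
    [exact HF3|].
  apply (continuity_pt_scal (fun y => Derive_n G 2 (INR N * y))).
  apply (continuity_pt_comp (fun y => INR N * y) (Derive_n G 2)); [|exact HG3].
  apply continuity_pt_filterlim, filterlim_scal.
Qed.

Lemma PiA_net_surplus (N : nat) (c mu r0 : R) (F G : R -> R) (Q qs : R -> R -> R)
    (p v : R) :
  c <> 0 ->
  PiA N c mu r0 F G Q qs p v
    = net_surplus N c F G (invest c mu r0 qs p v) - Q p v.
Proof.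
  intros Hc; unfold PiA, net_surplus; rewrite (ret_invest c) by exact Hc; ring.
Qed.

(** Derivatives of [ret] are [c] times those of [invest], so the terms in [r_pv e] and [r_p e_v]
    turn [c] into [2 * c] in the two brackets. The result is the chain-rule form
    [h'' e_p e_v + h' e_pv - Q_pv] with [h] equal to [net_surplus]. *)
Lemma Psi_net_surplus (N : nat) (c mu r0 : R) (F G : R -> R) (Q qs : R -> R -> R)
    (p v : R) :
  c <> 0 ->
  let e := invest c mu r0 qs in
  Psi N c mu r0 F G Q qs p v
    = INR N * (s2 N F G (e p v) - 2 * c) * D_p e p v * D_v e p v
      + INR N * (s1 N F G (e p v) - 2 * c * e p v) * D_pv e p v
      - D_pv Q p v.
Proof.
  intros Hc e.
  (* Stated at every point because it is differentiated in [x] below; [Derive_scal] is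
     unconditional, so no domain restriction arises. *)
  assert (Hv : forall x y, Derive (fun t => ret mu r0 qs x t) y = c * D_v e x y).
  { intros x y; unfold D_v, partial_derive; simpl.
    rewrite <- Derive_scal; apply Derive_ext; intros t; now apply ret_invest. }
  assert (Hp : D_p (ret mu r0 qs) p v = c * D_p e p v).
  { unfold D_p, partial_derive; simpl.
    rewrite <- Derive_scal; apply Derive_ext; intros t; now apply ret_invest. }
  assert (Hpv : D_pv (ret mu r0 qs) p v = c * D_pv e p v).
  { unfold D_pv, partial_derive; simpl.
    rewrite <- Derive_scal; apply Derive_ext; intros t; apply Hv. }
  unfold Psi, wedge; fold e; rewrite Hp, Hpv, (ret_invest c) by exact Hc.
  fold e; ring.
Qed.

Lemma is_cross_partial_ext (f g : R -> R -> R) (p v l : R) :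
  (forall x y, f x y = g x y) -> is_cross_partial f p v l -> is_cross_partial g p v l.
Proof.
  intros E [H1 H2]; split.
  - revert H1; apply filter_imp; intros x; apply ex_derive_ext; intros; apply E.
  - revert H2; apply is_derive_ext; intros x; apply Derive_ext; intros; apply E.
Qed.

Lemma is_cross_partial_PiA (N : nat) (c mu r0 : R) (F G : R -> R)
    (Q qs : R -> R -> R) (p v : R) :
  let e := invest c mu r0 qs in
  c <> 0 ->
  C2_near F (e p v) -> C2_near G (INR N * e p v) ->
  locally_2d (ex_diff_n e 2) p v -> locally_2d (ex_diff_n Q 2) p v ->
  is_cross_partial (PiA N c mu r0 F G Q qs) p v (Psi N c mu r0 F G Q qs p v).
Proof.
  intros e Hc HF HG He HQ.
  rewrite Psi_net_surplus by exact Hc; fold e.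
  apply (is_cross_partial_ext (fun x y => net_surplus N c F G (e x y) - Q x y)).
  { intros; symmetry; now apply PiA_net_surplus. }
  apply is_cross_partial_minus; [|now apply is_cross_partial_D_pv].
  apply (is_cross_partial_comp (net_surplus N c F G)
           (fun y => INR N * (s1 N F G y - 2 * c * y))).
  - now apply is_derive_net_surplus.
  - now apply is_derive_net_surplus'.
  - apply (locally_2d_singleton _ _ _ He).
  - now apply is_cross_partial_D_pv.
Qed.

Lemma continuity_2d_pt_Psi (N : nat) (c mu r0 : R) (F G : R -> R)
    (Q qs : R -> R -> R) (p v : R) :
  let e := invest c mu r0 qs in
  c <> 0 ->
  C2_near F (e p v) -> C2_near G (INR N * e p v) ->
  ex_diff_n e 2 p v -> ex_diff_n Q 2 p v ->
  continuity_2d_pt (Psi N c mu r0 F G Q qs) p v.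
Proof.
  intros e Hc HF HG He HQ.
  eapply continuity_2d_pt_ext;
    [intros; symmetry; now apply Psi_net_surplus|]; fold e.
  (* Smoothness of order two contains the joint continuity of [e], [e_p], [e_v] and [e_pv], and
     likewise of [Q_pv]. *)
  destruct He as (Hec & _ & _ & (Hep & _) & (Hev & _ & _ & (Hepv & _) & _)).
  destruct HQ as (_ & _ & _ & _ & (_ & _ & _ & (HQpv & _) & _)).
  apply continuity_2d_pt_minus; [|exact HQpv].
  apply continuity_2d_pt_plus; repeat apply continuity_2d_pt_mult;
    try apply continuity_2d_pt_const; trivial.
  - apply continuity_2d_pt_minus; [|apply continuity_2d_pt_const].
    apply (continuity_1d_2d_pt_comp (s2 N F G)); [|exact Hec].
    now apply continuity_pt_s2.
  - apply (continuity_2d_pt_ext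
             (fun x y => s1 N F G (e x y) - 2 * c * e x y)); [intros; ring|].
    apply continuity_2d_pt_minus.
    + apply (continuity_1d_2d_pt_comp (s1 N F G)); [|exact Hec].
      apply derivable_continuous_pt, ex_derive_Reals_0.
      destruct (C2_near_derive _ _ HF) as (_ & HF2 & _).
      destruct (C2_near_derive _ _ HG) as (_ & HG2 & _).
      apply (ex_derive_plus (Derive F) (fun y => Derive G (INR N * y)));
        [eexists; exact HF2|].
      apply (ex_derive_comp (Derive G) (fun y => INR N * y));
        [eexists; exact HG2|].
      apply (ex_derive_scal (fun y => y)), ex_derive_id.
    + apply continuity_2d_pt_mult; [apply continuity_2d_pt_const|exact Hec].
Qed.

(** * The destination's recognition *)

(** The midpoint of [q] and [q'] yields strictly more than the average of their payoffs and at most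
    the optimum, so that average lies below the optimum. *)
Lemma optimal_recognition_unique (c mu r0 : R) (D KB L : R -> R) (p v q q' : R) :
  strictly_concave_on unit_itv (fun q => PiB c mu r0 D KB L q p v) ->
  optimal_recognition c mu r0 D KB L p v q ->
  unit_itv q' -> q' <> q ->
  PiB c mu r0 D KB L q' p v < PiB c mu r0 D KB L q p v.
Proof.
  intros Hsc [Hq Hopt] Hq' Hne.
  specialize (Hsc q' q (1 / 2) Hq' Hq Hne ltac:(lra)).
  unfold plus, scal in Hsc; simpl in Hsc; unfold mult in Hsc; simpl in Hsc.
  unfold unit_itv in *.
  specialize (Hopt (1 / 2 * q' + (1 - 1 / 2) * q) ltac:(lra)).
  lra.
Qed.

(** The derivative of [L (p * t)] in [t] is [p * Derive L (p * t)], exactly the quantity whose sign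
    is assumed; this covers [p = 0] as well. *)
Lemma harm_monotone (L : R -> R) (p q q' : R) :
  (forall x, unit_itv x -> ex_derive L x) ->
  (forall p q, unit_itv p -> unit_itv q -> 0 <= p * Derive L (p * q)) ->
  unit_itv p -> unit_itv q -> unit_itv q' -> q <= q' ->
  L (p * q) <= L (p * q').
Proof.
  unfold unit_itv; intros HLd HL Hp Hq Hq' Hqq.
  destruct (MVT_derive (fun t => L (p * t)) (fun t => p * Derive L (p * t)) q q')
    as [t [Ht E]].
  - exact Hqq.
  - intros t Ht.
    evar_last.
    + apply (is_derive_comp L (fun t => p * t)).
      * apply Derive_correct, HLd; split; [apply Rmult_le_pos; lra|].
        rewrite <- (Rmult_1_r 1); apply Rmult_le_compat; lra.
      * apply (is_derive_scal (fun t => t)), is_derive_id.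
    + unfold scal; simpl; unfold mult, one; simpl; ring.
  - specialize (HL p t Hp ltac:(lra)).
    pose proof (Rmult_le_pos _ (q' - q) HL ltac:(lra)); lra.
Qed.

(* Revealed preference: adding the two optimality inequalities cancels
   everything but [(v' - v) * (L (p q') - L (p q))]. *)
Lemma recognition_monotone (c mu r0 : R) (D KB L : R -> R) (p v v' q q' : R) :
  (forall x, unit_itv x -> ex_derive L x) ->
  (forall p q, unit_itv p -> unit_itv q -> 0 <= p * Derive L (p * q)) ->
  strictly_concave_on unit_itv (fun q => PiB c mu r0 D KB L q p v) ->
  optimal_recognition c mu r0 D KB L p v q ->
  optimal_recognition c mu r0 D KB L p v' q' ->
  unit_itv p -> v <= v' -> q <= q'.
Proof.
  intros HLd HL Hsc Hq Hq' Hp Hvv.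
  destruct (Rle_or_lt q q') as [H|H]; [exact H|exfalso].
  (* The inequality at [v] has to be strict: two weak ones would be compatible when [v = v'] or when
     the two harms coincide. *)
  pose proof (optimal_recognition_unique _ _ _ _ _ _ _ _ _ q' Hsc Hq
                (proj1 Hq') ltac:(lra)) as H1.
  pose proof (proj2 Hq' q (proj1 Hq)) as H2.
  pose proof (harm_monotone L p q' q HLd HL Hp (proj1 Hq') (proj1 Hq) ltac:(lra)) as H3.
  unfold PiB in H1, H2.
  pose proof (Rmult_le_pos (v' - v) (L (p * q) - L (p * q')) ltac:(lra) ltac:(lra)).
  lra.
Qed.

Theorem proposition3
  (N : nat) (c mu r0 : R) (F G D KB L : R -> R) (Q qs : R -> R -> R)
  (HN : (2 <= N)%nat) (Hc : 0 < c) (Hmu : 0 < mu) (Hr0 : 0 <= r0)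
  (HF2 : forall x : R, 0 <= x -> C2_near F x)
  (HG2 : forall x : R, 0 <= x -> C2_near G x)
  (HF : forall x : R, 0 <= x -> 0 < Derive F x /\ Derive_n F 2 x <= 0)
  (HG : forall x : R, 0 <= x -> 0 < Derive G x /\ Derive_n G 2 x <= 0)
  (HD : concave_on (fun m : R => 0 <= m) D)
  (HKB : convex_on unit_itv KB)
  (HLd : forall x : R, unit_itv x -> ex_derive L x)
  (HL : forall p q : R, unit_itv p -> unit_itv q -> 0 <= p * Derive L (p * q))
  (Hqs : forall p v : R, unit_itv p -> unit_itv v ->
     optimal_recognition c mu r0 D KB L p v (qs p v))
  (HPiB : forall p v : R, unit_itv p -> unit_itv v ->
     strictly_concave_on unit_itv (fun q : R => PiB c mu r0 D KB L q p v))
  (HPiA : concave_on (fun z : R * R => unit_itv (fst z) /\ unit_itv (snd z))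
     (fun z : R * R => PiA N c mu r0 F G Q qs (fst z) (snd z))) :
  (forall p v v' : R, unit_itv p -> unit_itv v -> unit_itv v' -> v <= v' ->
     qs p v <= qs p v')
  /\
  (C2_on_square qs -> C2_on_square Q ->
     ((forall p v : R, unit_itv p -> unit_itv v ->
         is_cross_partial (PiA N c mu r0 F G Q qs) p v (Psi N c mu r0 F G Q qs p v))
      /\
      (forall a b a' b' : R, 0 <= a -> b <= 1 -> 0 <= a' -> b' <= 1 ->
         (forall p v : R, a <= p <= b -> a' <= v <= b' ->
            0 <= Psi N c mu r0 F G Q qs p v) ->
         strategic_complements_on_box a b a' b' (PiA N c mu r0 F G Q qs))
      /\
      (forall p v : R, unit_itv p -> unit_itv v ->
         Psi N c mu r0 F G Q qs p v < 0 ->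
         local_strategic_substitutes (PiA N c mu r0 F G Q qs) p v))
     /\
     (forall a b a' b' : R, 0 <= a -> b <= 1 -> 0 <= a' -> b' <= 1 ->
        (forall p v : R, a <= p <= b -> a' <= v <= b' ->
           complementarity_condition N c mu r0 F G Q qs p v) ->
        strategic_complements_on_box a b a' b' (PiA N c mu r0 F G Q qs))).
Proof.
  split.
  { intros p v v' Hp Hv Hv' Hvv.
    apply (recognition_monotone c mu r0 D KB L p v v'); auto. }
  intros Cq CQ.
  assert (He : forall p v, unit_itv p -> unit_itv v -> 0 <= invest c mu r0 qs p v).
  { intros p v Hp Hv; apply invest_nonneg; try apply Hp; trivial.
    apply (proj1 (Hqs p v Hp Hv)). }
  assert (HNe : forall p v, unit_itv p -> unit_itv v ->
                  0 <= INR N * invest c mu r0 qs p v).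
  { intros p v Hp Hv; apply Rmult_le_pos; [apply pos_INR|auto]. }
  pose proof (C2_on_square_invest c mu r0 qs Cq) as Ce.
  assert (Hc0 : c <> 0) by lra.
  assert (Hcross : forall p v, unit_itv p -> unit_itv v ->
            is_cross_partial (PiA N c mu r0 F G Q qs) p v
              (Psi N c mu r0 F G Q qs p v)).
  (* [He] and [HNe] allow [HF2] and [HG2] to be used at [e] and at [INR N * e]. *)
  { intros p v Hp Hv; apply is_cross_partial_PiA; auto. }
  assert (Hcompl : forall a b a' b', 0 <= a -> b <= 1 -> 0 <= a' -> b' <= 1 ->
            (forall p v, a <= p <= b -> a' <= v <= b' ->
               0 <= Psi N c mu r0 F G Q qs p v) ->
            strategic_complements_on_box a b a' b' (PiA N c mu r0 F G Q qs)).
  { intros a b a' b' Ha Hb Ha' Hb' H.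
    apply increasing_differences_of_cross with (l := Psi N c mu r0 F G Q qs).
    intros x y Hx Hy; split; [apply Hcross; unfold unit_itv; lra|auto]. }
  split; [split; [exact Hcross|split; [exact Hcompl|]]|].
  - intros p v Hp Hv Hneg.
    apply local_substitutes_of_cross with (l := Psi N c mu r0 F G Q qs); trivial.
    apply continuity_2d_pt_Psi; auto; apply locally_2d_singleton; auto.
  - intros a b a' b' Ha Hb Ha' Hb' H.
    apply Hcompl; trivial.
    intros p v Hp Hv; specialize (H p v Hp Hv).
    (* The sufficient condition is [0 <= Psi] with its terms moved across the inequality. *)
    unfold complementarity_condition in H; unfold Psi; lra.
Qed.
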